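(* Let $(X_1,F_1)$ and $(X_2,F_2)$ be finite ARS-fans and let $\rightsquigarrow_1$, $\rightsquigarrow_2$ denote their respective specialization orders. If the ordered sets $(X_1,\rightsquigarrow_1)$ and $(X_2,\rightsquigarrow_2)$ are order-isomorphic, then $(X_1,F_1)$ and $(X_2,F_2)$ are isomorphic abstract real spectra.
   Context: A ternary semigroup (TS) is a commutative monoid $(T,\cdot,1)$ with distinguished elements $0,-1$ such that, for all $x$: $x^3=x$; $x\cdot 0=0$; $-1\neq 1$ and $(-1)(-1)=1$; and $x=-x$ implies $x=0$ (where $-x:=(-1)\cdot x$). $\mathbf 3=\{1,0,-1\}$ with the usual multiplication is a TS. A real semigroup (RS) is a TS $G$ with a ternary relation ''$a\in D(b,c)$'' such that, writing $a\in D^t(b,c)$ for [$a\in D(b,c)$ and $-b\in D(-a,c)$ and $-c\in D(b,-a)$], for all $a,b,c,d,e\in G$: (RS0) $c\in D(a,b)\Leftrightarrow c\in D(b,a)$; (RS1) $a\in D(a,b)$; (RS2) $a\in D(b,c)\Rightarrow ad\in D(bd,cd)$; (RS3) $a\in D^t(b,c)$ and $c\in D^t(d,e)$ imply there is $x\in D^t(b,d)$ with $a\in D^t(x,e)$; (RS4) $e\in D(c^2a,d^2b)\Rightarrow e\in D(a,b)$; (RS5) $ad=bd$, $ae=be$, $c\in D(d,e)\Rightarrow ac=bc$; (RS6) $c\in D(a,b)\Rightarrow c\in D^t(c^2a,c^2b)$; (RS7) $D^t(a,-b)\cap D^t(b,-a)\neq\emptyset\Rightarrow a=b$; (RS8)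 $a\in D(b,c)\Rightarrow a^2\in D(b^2,c^2)$. Characters: $X_G$ is the set of maps $h:G\to\mathbf 3$ preserving product, $1,0,-1$, and such that $c\in D(a,b)$ implies $h(c)\in\{0,h(a),h(b)\}$. (Known duality: $c\in D(a,b)$ iff $h(c)\in\{0,h(a),h(b)\}$ for all $h\in X_G$, and $X_G$ separates points of $G$.) The pair $(X_G,G)$ is the abstract real spectrum (ARS) dual to $G$, and every ARS is of this form. Products of characters are pointwise; $Z(h):=h^{-1}[0]$. Specialization is the partial order $g\rightsquigarrow h$ iff $h^{-1}[1]\subseteq g^{-1}[1]$ (equivalently $h^2=hg$). An RS-fan is an RS $F$ such that $X_F$ is closed under (pointwise) products of any three of its elements; then $(X_F,F)$ is called an ARS-fan. For $a\in G$ let $\widehat a:X_G\to\mathbf 3$, $\widehat a(\sigma)=\sigma(a)$. An ARS-morphism $(X,G)\to(Y,H)$ is a map $\Phi:X\to Y$ such that for all $a\in H$ there is $b\in G$ with $\widehat a\circ\Phi=\widehat b$. An ARS-isomorphism is a bijection $\Phi$ such that $\Phi$ and $\Phi^{-1}$ are ARS-morphisms. *)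

(* Defs.v *)
From HB Require Import structures.
From mathcomp Require Import all_boot.
From mathcomp Require Import boolp classical_sets cardinality.

Set Implicit Arguments.
Unset Strict Implicit.
Unset Printing Implicit Defensive.

Local Open Scope classical_set_scope.
Local Open Scope group_scope.

(* [monoidType] bundles a choiceType structure; with the classical axioms of
   [boolp] every type carries one, so this is no restriction. *)
HB.mixin Record Monoid_isTernarySemigroup T of Monoid T := {
  tszero : T;
  tsmone : T;
  tsmulC : forall x y : T, x * y = y * x;
  tscube : forall x : T, x ^+ 3 = x;
  tsmul0 : forall x : T, x * tszero = tszero;
  tsmone_neq1 : tsmone <> 1;
  tsmone_sqr : tsmone * tsmone = 1;
  tsopp_fix : forall x : T, x = tsmone * x -> x = tszero
}.

#[short(type="ternarySemigroupType")]
HB.structure Definition TernarySemigroup :=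
  { T of Monoid_isTernarySemigroup T & Monoid T }.

Arguments tszero {s}.
Arguments tsmone {s}.

Definition tsopp (T : ternarySemigroupType) (x : T) : T := tsmone * x.

(* A ternary relation "a in D(b, c)" is encoded as D : T -> T -> set T, so that
   it is written [D b c a]. *)
Definition transversal (T : ternarySemigroupType) (D : T -> T -> set T)
    (b c : T) : set T :=
  [set a | [/\ D b c a, D (tsopp a) c (tsopp b) & D b (tsopp a) (tsopp c)]].

HB.mixin Record TernarySemigroup_isRealSemigroup G of TernarySemigroup G := {
  rsD : G -> G -> set G;
  RS0 : forall a b c : G, rsD a b c <-> rsD b a c;
  RS1 : forall a b : G, rsD a b a;
  RS2 : forall a b c d : G, rsD b c a -> rsD (b * d) (c * d) (a * d);
  RS3 : forall a b c d e : G,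
    transversal rsD b c a -> transversal rsD d e c ->
    exists2 x : G, transversal rsD b d x & transversal rsD x e a;
  RS4 : forall a b c d e : G, rsD (c ^+ 2 * a) (d ^+ 2 * b) e -> rsD a b e;
  RS5 : forall a b c d e : G,
    a * d = b * d -> a * e = b * e -> rsD d e c -> a * c = b * c;
  RS6 : forall a b c : G,
    rsD a b c -> transversal rsD (c ^+ 2 * a) (c ^+ 2 * b) c;
  RS7 : forall a b : G,
    transversal rsD a (tsopp b) `&` transversal rsD b (tsopp a) !=set0 -> a = b;
  RS8 : forall a b c : G, rsD b c a -> rsD (b ^+ 2) (c ^+ 2) (a ^+ 2)
}.

#[short(type="realSemigroupType")]
HB.structure Definition RealSemigroup :=
  { G of TernarySemigroup_isRealSemigroup G & TernarySemigroup G }.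

(* The ternary semigroup {-1, 0, 1}. *)
Inductive three := Neg3 | Zero3 | Pos3.

Definition three_code (x : three) : option bool :=
  match x with Neg3 => Some false | Zero3 => None | Pos3 => Some true end.

Definition three_decode (o : option bool) : three :=
  match o with Some false => Neg3 | None => Zero3 | Some true => Pos3 end.

Fact three_codeK : cancel three_code three_decode.
Proof. by case. Qed.

HB.instance Definition _ := Finite.copy three (can_type three_codeK).

Definition mul3 (x y : three) : three :=
  match x, y with
  | Zero3, _ | _, Zero3 => Zero3
  | Pos3, Pos3 | Neg3, Neg3 => Pos3
  | _, _ => Neg3
  end.

Fact mul3A : associative mul3. Proof. by do 3!case. Qed.
Fact mul1_3 : left_id Pos3 mul3. Proof. by case. Qed.
Fact mul3_1 : right_id Pos3 mul3. Proof. by case. Qed.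

HB.instance Definition _ := hasMul.Build three mul3.
HB.instance Definition _ := Magma_isSemigroup.Build three mul3A.
HB.instance Definition _ := Magma_isUMagma.Build three mul1_3 mul3_1.

Fact mul3C (x y : three) : x * y = y * x. Proof. by case: x; case: y. Qed.
Fact cube3 (x : three) : x ^+ 3 = x. Proof. by case: x. Qed.
Fact mul3_0 (x : three) : x * Zero3 = Zero3. Proof. by case: x. Qed.
Fact mone3_neq1 : Neg3 <> 1 :> three. Proof. by []. Qed.
Fact mone3_sqr : Neg3 * Neg3 = 1 :> three. Proof. by []. Qed.
Fact opp3_fix (x : three) : x = Neg3 * x -> x = Zero3. Proof. by case: x. Qed.

HB.instance Definition _ := Monoid_isTernarySemigroup.Build three
  mul3C cube3 mul3_0 mone3_neq1 mone3_sqr opp3_fix.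

Definition characters (G : realSemigroupType) : set (G -> three) :=
  [set h | [/\ {morph h : x y / x * y},
               h 1 = 1, h tszero = tszero, h tsmone = tsmone
             & forall a b c : G, rsD a b c -> h c \in [:: tszero; h a; h b]]].

Arguments characters G : clear implicits.

Definition specializes (G : realSemigroupType) (g h : characters G) : Prop :=
  \val h @^-1` [set 1] `<=` \val g @^-1` [set 1].

Definition RS_fan (F : realSemigroupType) : Prop :=
  forall g1 g2 g3 : F -> three,
    characters F g1 -> characters F g2 -> characters F g3 ->
    characters F (fun a => g1 a * g2 a * g3 a).

(* The pair (X_F, F) is represented by F alone; F acts as a set of functions on
   X_F (see [hat]), so that finiteness of the pair means finiteness of X_F. *)
Definition finite_ARS_fan (F : realSemigroupType) : Prop :=
  RS_fan F /\ finite_set (characters F).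

Definition hat (G : realSemigroupType) (a : G) (s : characters G) : three :=
  \val s a.

Definition ARS_morphism (G H : realSemigroupType)
    (Phi : characters G -> characters H) : Prop :=
  forall a : H, exists b : G, hat a \o Phi = hat b.

Definition ARS_isomorphic (G H : realSemigroupType) : Prop :=
  exists (Phi : characters G -> characters H)
         (Psi : characters H -> characters G),
    [/\ cancel Phi Psi, cancel Psi Phi, ARS_morphism Phi & ARS_morphism Psi].

Definition specialization_isomorphic (G H : realSemigroupType) : Prop :=
  exists2 f : characters G -> characters H, bijective f
    & forall g h, specializes g h <-> specializes (f g) (f h).

(* Main.v *)
(* In an RS-fan the zero sets of characters form a chain, so the finite set X of
   characters is stratified into levels by zero set; each level is, under the
   triple product, an affine space over F_2, and [g |-> h^2 g] gives affine
   maps from each level to those with larger zero sets, whose graphs are the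
   specialization order. Such a chain of finite affine spaces is determined up
   to isomorphism by the cardinalities of the images of its composite maps, which
   can be read off the order; the isomorphism is built one point at a time.
   Conversely the ARS structure is determined by the triple product: by linear
   duality on a level, every map X -> 3 compatible with triple products is the
   evaluation at an element of the fan. *)
From mathcomp Require Import all_boot.
From mathcomp Require Import boolp classical_sets cardinality.
Require Import Defs.

Set Implicit Arguments.
Unset Strict Implicit.
Unset Printing Implicit Defensive.

(** * Finite fans as sets of sign vectors *)

(** [tp x x y = y] means that every zero of [x] is a zero of [y], so [tp_chain] says that zero sets
    form a chain. *)
Record fan_space := FanSpace {
  point :> finType;
  coord : Type;
  ev : point -> coord -> three;
  tp : point -> point -> point -> point;
  ev_inj : forall x y, ev x =1 ev y -> x = y;
  ev_tp : forall x y z a,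
    ev (tp x y z) a = mul3 (mul3 (ev x a) (ev y a)) (ev z a);
  tp_chain : forall x y, tp x x y = y \/ tp y y x = x
}.

(** Evaluates the equations in the context at one coordinate and runs through the values in
    [three]. *)
Ltac at_point a :=
  repeat match goal with H : @eq _ _ _ |- _ =>
    move: H => /(congr1 (fun u => ev u a)); rewrite ?ev_tp end;
  rewrite ?ev_tp;
  repeat (let u := match goal with |- context [ev ?x a] => constr:(ev x a) end in
    case: u; rewrite //=).

Ltac pointwise := let a := fresh "a" in apply: ev_inj => a; at_point a.

(** * Levels, reach and tails *)

Section Levels.
Variable X : fan_space.
Implicit Types x y z u v w p g : X.

Definition spec x y := tp y y x == y.
(* The number of levels from that of [x] on: it decreases as zero sets grow. *)
Definition lev x := #|[set y | spec x y]|.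
Definition reach x := \max_(g | spec g x) lev g.

Lemma specxx x : spec x x.
Proof. apply/eqP; pointwise. Qed.

Lemma spec_trans y x z : spec x y -> spec y z -> spec x z.
Proof. move=> /eqP h1 /eqP h2; apply/eqP; pointwise. Qed.

(** If the zeros of [u] are zeros of [v], then [w |-> w^2 u] embeds the specializations of [v] in
    those of [u]. If this map is onto, [u] itself is some [w^2 u], and the zero sets coincide. *)
Lemma lev_leP x y : reflect (tp x x y = y) (lev y <= lev x).
Proof.
have img u v : tp u u v = v ->
    [set tp w w u | w in [set w | spec v w]] \subset [set w | spec u w] /\
    #|[set tp w w u | w in [set w | spec v w]]| = lev v.
  move=> uv; split.
    by apply/fintype.subsetP => _ /imsetP[w _ ->]; rewrite inE; apply/eqP; pointwise.
  apply: card_in_imset => w1 w2; rewrite !inE => /eqP h1 /eqP h2 h; pointwise.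
apply: (iffP idP) => [le_yx | xy].
  case: (tp_chain x y) => // yx.
  have [sub eqc] := img _ _ yx.
  have: y \in [set tp w w y | w in [set w | spec x w]].
    have /eqP -> : [set tp w w y | w in [set w | spec x w]] == [set w | spec y w].
      by rewrite eqEcard sub eqc.
    by rewrite inE specxx.
  move=> /imsetP[w]; rewrite inE => /eqP h1 h2; pointwise.
by have [sub <-] := img _ _ xy; apply: subset_leq_card.
Qed.

Lemma spec_lev x y : spec x y -> lev y <= lev x.
Proof. by move=> /eqP h; apply/lev_leP; pointwise. Qed.

(** The zero set of a product is the union of three nested sets, hence the largest of them. *)
Lemma lev_tp x y z : lev (tp x y z) = minn (minn (lev x) (lev y)) (lev z).
Proof.
apply/eqP; rewrite eqn_leq !leq_min; apply/andP; split.
  by rewrite -andbA; apply/and3P; split; apply/lev_leP; pointwise.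
case: (leqP (lev x) (lev y)) => [/lev_leP h1 | /ltnW/lev_leP h1].
  case: (leqP (lev x) (lev z)) => [/lev_leP h2 | /ltnW/lev_leP h2];
  apply/lev_leP; pointwise.
case: (leqP (lev y) (lev z)) => [/lev_leP h2 | /ltnW/lev_leP h2];
  apply/lev_leP; pointwise.
Qed.

(** A specialization of [p] is [p] cut down to a smaller support, so its zero set determines it. *)
Lemma lev_inj_above p x y : spec p x -> spec p y -> lev x = lev y -> x = y.
Proof.
move=> /eqP h1 /eqP h2 h.
have /lev_leP h3 : lev x <= lev y by rewrite h.
have /lev_leP h4 : lev y <= lev x by rewrite h.
clear h; pointwise.
Qed.

Lemma lev_le_reach g x : spec g x -> lev g <= reach x.
Proof. exact: (@leq_bigmax_cond _ (fun u => spec u x) lev g). Qed.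

Lemma reachP x : exists2 g, spec g x & lev g = reach x.
Proof.
have h : 0 < #|[pred g | spec g x]| by apply/card_gt0P; exists x; apply: specxx.
by case: (eq_bigmax_cond lev h) => g hg e; exists g.
Qed.

(** A product of generizations is a generization of the product. *)
Lemma reach_tp x y z :
  minn (minn (reach x) (reach y)) (reach z) <= reach (tp x y z).
Proof.
have [gx /eqP sx <-] := reachP x; have [gy /eqP sy <-] := reachP y.
have [gz /eqP sz <-] := reachP z; rewrite -lev_tp; apply: lev_le_reach.
apply/eqP; pointwise.
Qed.

(* The tail of [x] strictly beyond level [i] is the tail of [z]. *)
Definition same_above i x z :=
  [forall v, (lev v < i) ==> (tp v v x == tp v v z)].

Lemma same_aboveP i x z :
  reflect (forall v, lev v < i -> tp v v x = tp v v z) (same_above i x z).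
Proof.
apply: (iffP forallP) => h v; first by move/(implyP (h v))/eqP.
by apply/implyP => /h ->.
Qed.

Lemma same_above_spec i x z : i <= lev x ->
  (forall v, lev v < i -> spec x v -> spec z v) -> same_above i x z.
Proof.
move=> ix h; apply/same_aboveP => v vi.
have /lev_leP xv : lev v <= lev x by apply: leq_trans ix; apply: ltnW.
have /eqP : spec z (tp v v x).
  apply: h; last by apply/eqP; pointwise.
  by rewrite lev_tp minnn; apply: leq_ltn_trans vi; apply: geq_minl.
move=> h1; pointwise.
Qed.

(** On one level [w |-> w p x] is an involution, so [reach_tp] applies in both directions. *)
Lemma reach_translate k w p x : lev w = lev x -> lev p = lev x ->
  k <= reach p -> reach x = k -> reach (tp w p x) <= k ->
  reach (tp w p x) = minn (reach w) k.
Proof.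
move=> wx px kp xk le_k; apply/eqP; rewrite eqn_leq; apply/andP; split.
  rewrite leq_min le_k andbT.
  have {2}-> : w = tp (tp w p x) p x.
    have /lev_leP h1 : lev w <= lev p by rewrite wx px.
    have /lev_leP h2 : lev w <= lev x by rewrite wx.
    clear - h1 h2; pointwise.
  apply: leq_trans (reach_tp _ _ _); rewrite xk !leq_min leqnn le_k andbT /=.
  exact: leq_trans kp.
apply: leq_trans (reach_tp _ _ _).
by rewrite xk !leq_min geq_minl geq_minr andbT (leq_trans (geq_minr _ _)).
Qed.

End Levels.

(** * Invariants of an order isomorphism, and partial isomorphisms *)

Section OrderIsomorphism.
Variables (X Y : fan_space) (f : X -> Y).
Implicit Types x z v w p : X.
Hypotheses (f_bij : bijective f) (f_spec : forall x y, spec (f x) (f y) = spec x y).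

Lemma card_order_iso (A : {set X}) (B : {set Y}) :
  (forall x, (f x \in B) = (x \in A)) -> #|B| = #|A|.
Proof.
move=> fAB; rewrite -(on_card_preimset (f := f)); last exact: onW_bij.
by apply: eq_card => x; rewrite inE fAB.
Qed.

Lemma lev_order_iso x : lev (f x) = lev x.
Proof. by apply: card_order_iso => y; rewrite !inE. Qed.

Lemma reach_order_iso x : reach (f x) = reach x.
Proof.
apply/eqP; rewrite eqn_leq; apply/andP; split; last first.
  have [g gx <-] := reachP x; rewrite -lev_order_iso.
  by apply: lev_le_reach; rewrite f_spec.
have [g gx <-] := reachP (f x); have [f' _ f'K] := f_bij.
by rewrite -[g]f'K lev_order_iso lev_le_reach // -f_spec f'K.
Qed.

Lemma same_above_order_iso i x z : i <= lev x -> i <= lev z ->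
  same_above i (f x) (f z) = same_above i x z.
Proof.
have above (Z : fan_space) (u v w : Z) : tp v v u = tp v v w -> spec u v -> spec w v.
  by move=> h /eqP h1; apply/eqP; pointwise.
move=> ix iz; have [f' _ f'K] := f_bij; apply/idP/idP => /same_aboveP h;
  apply: same_above_spec; rewrite ?lev_order_iso // => v vi.
  by rewrite -!f_spec; apply: above; apply: h; rewrite lev_order_iso.
rewrite -[v]f'K !f_spec; apply: above; apply: h.
by rewrite -lev_order_iso f'K.
Qed.

(* [reach] is what makes the back-and-forth work: for [i <= k] the points of
   level [i] and reach [>= k] are the image of level [k] in level [i]. *)
Record partial_iso (p0 : X) (S : {set X}) (phi : X -> Y) : Prop := PartialIso {
  piso_base : [set w | spec p0 w] \subset S;
  piso_closed : {in S & &, forall x y z, tp x y z \in S};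
  piso_tp : {in S & &, forall x y z, phi (tp x y z) = tp (phi x) (phi y) (phi z)};
  piso_inj : {in S &, injective phi};
  piso_lev : {in S, forall x, lev (phi x) = lev x};
  piso_reach : {in S, forall x, reach (phi x) = reach x}
}.

(** The tail of a point has at most one point per level, and [f] preserves levels, so [f] respects
    products there. *)
Lemma partial_iso_tail p0 : partial_iso p0 [set w | spec p0 w] f.
Proof.
have closed (Z : fan_space) (p x y z : Z) :
    spec p x -> spec p y -> spec p z -> spec p (tp x y z).
  by move=> /eqP h1 /eqP h2 /eqP h3; apply/eqP; pointwise.
split=> //.
- by move=> x y z; rewrite !inE; apply: closed.
- move=> x y z; rewrite !inE => hx hy hz; apply: (@lev_inj_above _ (f p0)).
  + by rewrite f_spec closed.
  + by rewrite closed ?f_spec.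
  by rewrite lev_tp !lev_order_iso lev_tp.
- by move=> x y _ _; apply: bij_inj.
- by move=> x _; apply: lev_order_iso.
- by move=> x _; apply: reach_order_iso.
Qed.

(** * Extending a partial isomorphism by one point *)

Section Extension.
Variables (p0 : X) (S : {set X}) (phi : X -> Y).
Hypotheses (p0_max : forall w, lev w <= lev p0) (phiP : partial_iso p0 S phi).

Variable x : X.
Hypotheses (xS : x \notin S)
  (low_S : forall z, lev z < lev x -> z \in S)
  (far_S : forall z, lev z = lev x -> reach x < reach z -> z \in S).

(** The point of the tail of [p0] at the level of [x] serves as the origin of that level; its reach
    is maximal because the level of [p0] is. *)
Lemma base_point :
  exists2 p, p \in S & lev p = lev x /\ forall z, reach z <= reach p.
Proof.
have /lev_leP h : lev x <= lev p0 by apply: p0_max.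
have h1 : spec p0 (tp x x p0) by apply/eqP; pointwise.
exists (tp x x p0).
  by apply: (fintype.subsetP (piso_base phiP)); rewrite inE.
split=> [|z]; first by rewrite lev_tp minnn; apply/minn_idPl.
apply: leq_trans (lev_le_reach h1).
by have [g _ <-] := reachP z.
Qed.

Lemma target_germ : exists y0 : Y,
  [/\ lev y0 = lev x, reach x <= reach y0 &
      forall v, lev v < lev x -> spec x v -> spec y0 (phi v)].
Proof.
case: (pickP [pred v | (lev v < lev x) && spec x v]) => [v1 /= v1P | none].
  (* The nearest strict specialization [v] of [x] determines the rest of the tail. As [phi]
     preserves reach, [phi v] lifts to some [g] of level at least [lev x]; the square of [phi p]
     brings [g] down to the level of [x]. *)
  case: (@arg_maxnP _ v1 [pred v | (lev v < lev x) && spec x v] (@lev X) v1P).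
  move=> v /andP[vx xv] vmax.
  have [p pS [px _]] := base_point.
  have vS := low_S vx.
  have [g /eqP gv gr] := reachP (phi v).
  have xg : lev x <= lev g.
    by rewrite gr (piso_reach phiP) //; apply: lev_le_reach.
  have qx : lev (phi p) = lev x by rewrite (piso_lev phiP).
  have /lev_leP vp : lev (phi v) <= lev (phi p).
    by rewrite qx (piso_lev phiP) // ltnW.
  have /lev_leP gp : lev (phi p) <= lev g by rewrite qx.
  exists (tp (phi p) (phi p) g); split.
  - by rewrite lev_tp minnn qx; apply/minn_idPl.
  - apply: (@leq_trans (lev g)); last first.
      by apply: lev_le_reach; apply/eqP; clear - gp; pointwise.
    rewrite gr (piso_reach phiP) //; have [h hx <-] := reachP x.
    by apply: lev_le_reach; apply: spec_trans hx xv.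
  - move=> v' v'x xv'; have v'S := low_S v'x.
    have /lev_leP vv' : lev v' <= lev v by apply: vmax; rewrite /= v'x.
    have e : tp v' v' v = v'.
      by move/eqP: xv => xv; move/eqP: xv' => xv'; clear - vv' xv xv'; pointwise.
    apply: (@spec_trans _ (phi v)); last by apply/eqP; rewrite -(piso_tp phiP) ?e.
    by apply/eqP; clear - vp gv gp; pointwise.
(* An empty tail leaves only level and reach to match. *)
exists (f x); rewrite lev_order_iso reach_order_iso; split=> // v vx xv.
by move: (none v); rewrite /= vx xv.
Qed.

(* The fibre of [x] over the levels already treated has as many points of reach
   [>= reach x] as the one of its image; [x] is not in [S], so [phi] cannot
   exhaust the latter. *)
Lemma fresh_target : exists y : Y,
  [/\ y \notin phi @: S, lev y = lev x, reach x <= reach y &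
      forall v, lev v < lev x -> tp (phi v) (phi v) y = phi (tp v v x)].
Proof.
have [y0 [y0x y0r y0v]] := target_germ.
pose Fx := [set z | [&& lev z == lev x, reach x <= reach z
                     & same_above (lev x) x z]].
pose Fx' := [set z | [&& lev z == lev x, reach x <= reach z
                      & same_above (lev x) (f x) z]].
pose Fy := [set z | [&& lev z == lev x, reach x <= reach z
                     & same_above (lev x) y0 z]].
have cardF : #|Fx'| = #|Fx|.
  apply: card_order_iso => z; rewrite !inE lev_order_iso reach_order_iso.
  by case: eqP => //= zx; rewrite same_above_order_iso // zx.
have cardFy : #|Fx'| <= #|Fy|.
  (* Translation by [f x] and [y0] carries the fibre of [f x] injectively into that of [y0]. *)
  rewrite -(card_in_imset (f := fun z : Y => tp z (f x) y0)).
    apply: subset_leq_card; apply/fintype.subsetP => _ /imsetP[z + ->].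
    rewrite !inE => /and3P[/eqP zx zr /same_aboveP zs].
    rewrite lev_tp zx lev_order_iso y0x !minnn eqxx /=; apply/andP; split.
      by apply: leq_trans (reach_tp _ _ _); rewrite !leq_min zr y0r reach_order_iso leqnn.
    apply/same_aboveP => v vx; have e := zs _ vx.
    have /lev_leP vfx : lev v <= lev (f x) by rewrite lev_order_iso ltnW.
    have /lev_leP vy : lev v <= lev y0 by rewrite y0x ltnW.
    by clear - e vfx vy; pointwise.
  move=> z1 z2; rewrite !inE => /and3P[/eqP z1x _ _] /and3P[/eqP z2x _ _] e.
  have /lev_leP h1 : lev z1 <= lev (f x) by rewrite lev_order_iso z1x.
  have /lev_leP h2 : lev z2 <= lev (f x) by rewrite lev_order_iso z2x.
  have /lev_leP h3 : lev z1 <= lev y0 by rewrite z1x y0x.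
  have /lev_leP h4 : lev z2 <= lev y0 by rewrite z2x y0x.
  have /lev_leP h5 : lev z1 <= lev z2 by rewrite z1x z2x.
  have /lev_leP h6 : lev z2 <= lev z1 by rewrite z1x z2x.
  by clear - h1 h2 h3 h4 h5 h6 e; pointwise.
have : ~~ (Fy \subset phi @: (S :&: Fx)).
  apply/negP => /subset_leq_card; apply/negP; rewrite -ltnNge.
  apply: leq_ltn_trans (leq_imset_card _ _) _.
  apply: leq_trans cardFy; rewrite cardF; apply: proper_card; apply/properP.
  split; first exact: subsetIr.
  exists x; last by rewrite inE (negbTE xS).
  by rewrite inE eqxx leqnn; apply/same_aboveP.
move/subsetPn => [y]; rewrite inE => /and3P[/eqP yx yr /same_aboveP ys] yn.
have yv v : lev v < lev x -> spec x v -> spec y (phi v).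
  move=> vx xv; have /eqP h := y0v _ vx xv.
  have e : tp (phi v) (phi v) y0 = tp (phi v) (phi v) y.
    by apply: ys; rewrite (piso_lev phiP) ?low_S.
  by apply/eqP; clear - h e; pointwise.
exists y; split=> //.
  (* A preimage of [y] in [S] would share the tail of [x], hence lie in [Fx]. *)
  apply/imsetP => -[s sS ys']; move/imsetP: yn => []; exists s => //.
  rewrite !inE sS /=. rewrite -(piso_lev phiP) //. rewrite -ys' yx eqxx.
  rewrite -[reach s](piso_reach phiP) // -ys' yr /=.
  apply: same_above_spec => // v vx xv; have := yv _ vx xv.
  have vS := low_S vx; rewrite ys' /spec -(piso_tp phiP) // => /eqP h.
  by apply/eqP/(piso_inj phiP) => //; apply: (piso_closed phiP).
(* For general [v], pass to [v^2 x], which has the level of [v] and lies in the tail of [x]. *)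
move=> v vx; have /lev_leP xv : lev v <= lev x by apply: ltnW.
have lw : lev (tp v v x) < lev x.
  by rewrite lev_tp minnn; apply: leq_ltn_trans vx; apply: geq_minl.
have /eqP h : spec y (phi (tp v v x)) by apply: yv => //; apply/eqP; clear; pointwise.
have vS := low_S vx; have wS := low_S lw.
have /lev_leP h1 : lev (phi v) <= lev (phi (tp v v x)).
  by rewrite !(piso_lev phiP) //; apply/lev_leP; clear - xv; pointwise.
have /lev_leP h2 : lev (phi (tp v v x)) <= lev (phi v).
  by rewrite !(piso_lev phiP) //; apply/lev_leP; clear; pointwise.
by clear - h h1 h2; pointwise.
Qed.

(** By [far_S], all points of this level with reach beyond [reach x] lie in [S]. [Y] has equally
    many, so their images exhaust those of [Y]. *)
Lemma reach_fresh (y : Y) :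
  y \notin phi @: S -> lev y = lev x -> reach y <= reach x.
Proof.
move=> yS yx; rewrite leqNgt; apply: contra yS => yr.
pose A := [set z : X | (lev z == lev x) && (reach x < reach z)].
pose B := [set z : Y | (lev z == lev x) && (reach x < reach z)].
have AS : A \subset S.
  by apply/fintype.subsetP => z; rewrite inE => /andP[/eqP]; apply: far_S.
have cardB : #|B| = #|A|.
  by apply: card_order_iso => z; rewrite !inE lev_order_iso reach_order_iso.
have injA : {in A &, injective phi}.
  by move=> u v /(fintype.subsetP AS) uS /(fintype.subsetP AS); apply: (piso_inj phiP).
have /eqP eAB : phi @: A == B.
  rewrite eqEcard card_in_imset // cardB leqnn andbT.
  apply/fintype.subsetP => _ /imsetP[z zA ->]; have zS := fintype.subsetP AS z zA.
  by move: zA; rewrite !inE (piso_lev phiP) // (piso_reach phiP).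
apply: (fintype.subsetP (imsetS phi AS)).
by rewrite eAB inE yx eqxx.
Qed.

(** The span of [S] and [x] adds only the translates [w p x], which are sent to [(phi w) q y]. *)
Lemma partial_iso_extend : exists (S' : {set X}) phi', S \proper S' /\ partial_iso p0 S' phi'.
Proof.
have [p pS [px p_max]] := base_point.
have [y [yS yx yr yv]] := fresh_target.
set q := phi p.
have qx : lev q = lev x by rewrite (piso_lev phiP).
have ry : reach y = reach x by apply/eqP; rewrite eqn_leq yr reach_fresh.
have /lev_leP xp : lev x <= lev p by rewrite px.
have /lev_leP px' : lev p <= lev x by rewrite px.
have /lev_leP yq : lev y <= lev q by rewrite qx yx.
have /lev_leP qy : lev q <= lev y by rewrite qx yx.
pose S' : {set X} := S :|: [set tp w p x | w in S].
(* For a new [z = w p x], the product [z x p] recovers the projection [p^2 w] of [w]. *)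
pose phi' (z : X) : Y := if z \in S then phi z else tp (phi (tp z x p)) q y.
have old z : z \in S -> phi' z = phi z by rewrite /phi' => ->.
have newS w : w \in S -> (tp w p x \in S) = (lev w < lev x).
  move=> wS; apply/idP/idP => [zS | wx]; last first.
    apply: low_S; rewrite !lev_tp; apply: leq_ltn_trans wx.
    by rewrite -minnA geq_minl.
  rewrite ltnNge; apply: contra xS => /lev_leP wx.
  suff -> : x = tp (tp w p x) w p by apply: (piso_closed phiP).
  by clear - wx xp; pointwise.
(* Below the level of [x] both clauses of [phi'] must agree: there [w p x = w p (w^2 x)] with
   [w^2 x] in [S], and [yv] applies. *)
have new w : w \in S -> phi' (tp w p x) = tp (phi w) q y.
  move=> wS; rewrite /phi' newS //; case: ltnP => wx.
    have xS' : tp w w x \in S.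
      by apply: low_S; rewrite lev_tp minnn; apply: leq_ltn_trans wx; apply: geq_minl.
    have -> : tp w p x = tp w p (tp w w x) by clear; pointwise.
    by rewrite (piso_tp phiP) // -/q -yv //; clear; pointwise.
  have -> : tp (tp w p x) x p = tp p p w by clear - xp px'; pointwise.
  by rewrite (piso_tp phiP) // -/q; clear; pointwise.
have S'P z : z \in S' -> z \in S \/ exists2 w, w \in S & z = tp w p x.
  by rewrite inE => /orP[|/imsetP[w]]; [left | right; exists w].
have inS' w : w \in S -> tp w p x \in S'.
  by move=> wS; rewrite inE; apply/orP; right; apply/imsetP; exists w.
have SS' w : w \in S -> w \in S' by rewrite inE => ->.
have cl := piso_closed phiP.
have mor := piso_tp phiP.
have closed_tp : {in S' & &, forall u v w, tp u v w \in S' /\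
    phi' (tp u v w) = tp (phi' u) (phi' v) (phi' w)}.
  move=> z1 z2 z3 /S'P h1 /S'P h2 /S'P h3.
  (* The parity of the number of new factors decides: an odd number leaves one factor [p x], an even
     nonzero number leaves [p^2]. *)
  have odd w1 w2 w3 z : w1 \in S -> w2 \in S -> w3 \in S ->
      z = tp (tp w1 w2 w3) p x ->
      z \in S' /\ phi' z = tp (tp (phi w1) (phi w2) (phi w3)) q y.
    by move=> ? ? ? ->; split; [apply/inS'/cl | rewrite new ?mor // cl].
  have even w1 w2 w3 z : w1 \in S -> w2 \in S -> w3 \in S ->
      z = tp p p (tp w1 w2 w3) ->
      z \in S' /\ phi' z = tp q q (tp (phi w1) (phi w2) (phi w3)).
    move=> ? ? ? ->; have W : tp w1 w2 w3 \in S by apply: cl.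
    by rewrite old ?mor ?cl // SS' // cl.
  case: h1 => [w1S|[w1 w1S ->]]; case: h2 => [w2S|[w2 w2S ->]];
  case: h3 => [w3S|[w3 w3S ->]]; rewrite ?new // ?(old _ w1S) ?(old _ w2S) ?(old _ w3S).
  - by rewrite old ?cl // mor // SS' // cl.
  - case: (odd z1 z2 w3 (tp z1 z2 (tp w3 p x))) => // [|-> ->].
      by clear; pointwise.
    by split=> //; clear; pointwise.
  - case: (odd z1 w2 z3 (tp z1 (tp w2 p x) z3)) => // [|-> ->].
      by clear; pointwise.
    by split=> //; clear; pointwise.
  - case: (even z1 w2 w3 (tp z1 (tp w2 p x) (tp w3 p x))) => // [|-> ->].
      by clear - xp px'; pointwise.
    by split=> //; clear - yq qy; pointwise.
  - case: (odd w1 z2 z3 (tp (tp w1 p x) z2 z3)) => // [|-> ->].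
      by clear; pointwise.
    by split=> //; clear; pointwise.
  - case: (even w1 z2 w3 (tp (tp w1 p x) z2 (tp w3 p x))) => // [|-> ->].
      by clear - xp px'; pointwise.
    by split=> //; clear - yq qy; pointwise.
  - case: (even w1 w2 z3 (tp (tp w1 p x) (tp w2 p x) z3)) => // [|-> ->].
      by clear - xp px'; pointwise.
    by split=> //; clear - yq qy; pointwise.
  - case: (odd w1 w2 w3 (tp (tp w1 p x) (tp w2 p x) (tp w3 p x))) => // [|-> ->].
      by clear - xp px'; pointwise.
    by split=> //; clear - yq qy; pointwise.
(* At the level of [x] such a coincidence would give [y = phi (u w p)], although [y] is fresh. *)
have cross u w : u \in S -> w \in S -> phi u = tp (phi w) q y -> u = tp w p x.
  move=> uS wS e; case: (ltnP (lev w) (lev x)) => wx.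
    have zS : tp w p x \in S by rewrite newS.
    by apply: (piso_inj phiP) => //; rewrite e -new // old.
  case/imsetP: yS; exists (tp u w p); first exact: cl.
  have /lev_leP wy : lev y <= lev (phi w) by rewrite yx (piso_lev phiP).
  by rewrite mor // -/q; clear - e wy yq; pointwise.
exists S', phi'; split.
  apply/properP; split; first exact: finset.subsetUl.
  exists x => //; have -> : x = tp p p x by [].
  exact: inS'.
split.
- by apply: fintype.subset_trans (piso_base phiP) (finset.subsetUl _ _).
- by move=> u v w uS vS wS; case: (closed_tp u v w).
- by move=> u v w uS vS wS; case: (closed_tp u v w).
- move=> z1 z2 /S'P[z1S|[w1 w1S ->]] /S'P[z2S|[w2 w2S ->]];
    rewrite ?new // ?(old _ z1S) ?(old _ z2S).
  + exact: (piso_inj phiP).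
  + exact: cross.
  + by move/esym/cross => ->.
  move=> e; have : phi (tp p p w1) = phi (tp p p w2).
    by rewrite !mor // -/q; clear - e yq qy; pointwise.
  move/(piso_inj phiP); rewrite !cl // => /(_ isT isT).
  by clear - xp; move=> e; pointwise.
- move=> z /S'P[zS|[w wS ->]]; first by rewrite old // (piso_lev phiP).
  by rewrite new // !lev_tp qx yx px (piso_lev phiP).
- move=> z zS'; have [zS|zS] := boolP (z \in S).
    by rewrite old // (piso_reach phiP).
  have [|[w wS e]] := S'P _ zS'; first by rewrite (negbTE zS).
  have xw : lev x <= lev w by rewrite leqNgt -newS // -e.
  (* Only the projection [p^2 w] of [w] to the level of [x] matters. *)
  have WS : tp p p w \in S by apply: cl.
  have Wx : lev (tp p p w) = lev x by rewrite lev_tp minnn px; apply/minn_idPl.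
  have {xw}e : z = tp (tp p p w) p x by rewrite e; clear; pointwise.
  move: (tp p p w) WS Wx e => {wS}{}w wS wx e.
  have zx : lev z = lev x by rewrite e !lev_tp wx px !minnn.
  have zr : reach z <= reach x.
    by rewrite leqNgt; apply: contra zS => /(far_S zx).
  have fzS : tp (phi w) q y \notin phi @: S.
    by apply: contra zS => /imsetP[u uS fu]; rewrite e -(cross u w).
  have yw : lev (phi w) = lev x by rewrite (piso_lev phiP).
  (* Neither the new point nor its image reaches beyond [reach x], so both reaches equal the minimum
     of [reach w] and [reach x]. *)
  rewrite e new // (@reach_translate X (reach x)) ?wx ?px //; last by rewrite -e.
  rewrite (@reach_translate Y (reach x)) ?yw ?qx ?yx //.
  + by rewrite (piso_reach phiP).
  + by rewrite (piso_reach phiP).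
  + by apply: reach_fresh => //; rewrite !lev_tp yw qx yx !minnn.
Qed.

End Extension.
(** Points are adjoined by least level first and, within a level, greatest reach first, as [low_S]
    and [far_S] demand. *)
Lemma partial_iso_full p0 S phi :
  (forall w, lev w <= lev p0) -> partial_iso p0 S phi ->
  exists psi, partial_iso p0 [set: X]%SET psi.
Proof.
move=> p0_max; have [n] := ubnP #|~: S|.
elim: n S phi => // n IHn S phi leSn phiP.
have [x0 x0S | allS] := pickP [pred x | x \notin S]; last first.
  exists phi; suff <- : S = [set: X]%SET by [].
  by apply/setP => x; rewrite inE; apply/negbFE/allS.
have [x1 x1S x1min] := @arg_minnP _ x0 [pred x | x \notin S] (@lev X) x0S.
have x1P : [pred x | (x \notin S) && (lev x == lev x1)] x1.
  by rewrite /= eqxx andbT.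
case: (@arg_maxnP _ x1 _ (@reach X) x1P) => x /andP[xS /eqP xx1] xmax.
have [||S' [phi' [prS' phi'P]]] := partial_iso_extend p0_max phiP xS.
- move=> z; rewrite xx1 ltnNge; apply: contraR; exact: x1min.
- move=> z zx; rewrite ltnNge; apply: contraR => zS.
  by apply: xmax; rewrite /= zS zx xx1 eqxx.
rewrite ltnS in leSn; apply: IHn phi'P; apply: leq_trans leSn.
by apply: proper_card; rewrite finset.properC.
Qed.

Lemma order_iso_tp_iso :
  exists2 psi : X -> Y, bijective psi &
    forall x y z, psi (tp x y z) = tp (psi x) (psi y) (psi z).
Proof.
have [x0 _ | X0] := pickP (@predT X); last first.
  by exists f => // x; have := X0 x.
have [p0 _ p0_max] := @arg_maxnP _ x0 predT (@lev X) isT.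
have [|psi psiP] := partial_iso_full _ (partial_iso_tail p0).
  by move=> w; apply: p0_max.
exists psi; last by move=> x y z; apply: (piso_tp psiP); rewrite inE.
apply: inj_card_bij; last by rewrite (bij_eq_card f_bij).
by move=> x y; apply: (piso_inj psiP); rewrite inE.
Qed.

End OrderIsomorphism.

(** * Maps compatible with triple products are evaluations *)

Section Representation.
Variable X : fan_space.
Hypotheses
  (coord_const : forall c, exists a, forall x : X, ev x a = c)
  (coord_mul : forall a b : coord X,
     exists c, forall x : X, ev x c = mul3 (ev x a) (ev x b)).

Definition tp_mul (phi : X -> three) :=
  forall x y z, phi (tp x y z) = mul3 (mul3 (phi x) (phi y)) (phi z).

Lemma tp_mul_neq0 phi (x z : X) : tp_mul phi -> lev x <= lev z ->
  phi x <> Zero3 -> phi z <> Zero3.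
Proof. by move=> phiM /lev_leP <-; rewrite phiM => /[swap] ->. Qed.

Lemma tp_mul_ev a : tp_mul (fun x => ev x a).
Proof. by move=> x y z; apply: ev_tp. Qed.

(* A functional constant on the fibres of [b, L] becomes, possibly after
   multiplication by [b], constant on the fibres of [L]. *)
Lemma tp_mul_rep_level (I : eqType) (B : I -> coord X) (L : seq I) (x0 : X) phi :
  (forall p, ev x0 (B p) <> Zero3) -> tp_mul phi -> phi x0 <> Zero3 ->
  (forall s t : X, lev s = lev x0 -> lev t = lev x0 ->
     all (fun p => ev s (B p) == ev t (B p)) L -> phi s = phi t) ->
  exists a, forall s : X, lev s = lev x0 -> ev s a = phi s.
Proof.
move=> B0; elim: L phi => [|p L IHL] phi phiM phi0 fib.
  by have [a ha] := coord_const (phi x0); exists a => s sx; rewrite ha (fib s x0).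
pose agree (s t : X) := all (fun p => ev s (B p) == ev t (B p)) L.
have [/existsP[s /existsP[t /and4P[/eqP sx /eqP tx st phist]]] | none] := boolP
  [exists s, exists t, [&& lev s == lev x0, lev t == lev x0, agree s t & phi s != phi t]];
  last first.
  apply: IHL => // s t sx tx st; apply/eqP; apply: contraR none => phist.
  by apply/existsP; exists s; apply/existsP; exists t; rewrite sx tx !eqxx /agree st phist.
set b := B p; have bM := tp_mul_ev b.
pose phib (x : X) := mul3 (phi x) (ev x b).
have unit z : lev z = lev x0 -> ev z b <> Zero3 /\ phi z <> Zero3.
  by move=> zx; split; [apply: (tp_mul_neq0 bM _ (B0 p)) | apply: (tp_mul_neq0 phiM _ phi0)]; rewrite zx.
have bst : ev s b != ev t b.
  apply: contra phist => e; apply/eqP/fib => //=.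
  by rewrite -/b e.
have phibM : tp_mul phib.
  move=> x y z; rewrite /phib phiM bM.
  by case: (phi x) (phi y) (phi z) (ev x b) (ev y b) (ev z b) => [] [] [] [] [] [].
have [||a ha] := IHL phib phibM.
- by have [] := unit x0 erefl; rewrite /phib; case: (phi x0) (ev x0 b) => [] [].
- move=> u v ux vx uv; rewrite /phib.
  have [eb | neb] := eqVneq (ev u b) (ev v b).
    by rewrite eb (fib u v) //= -/b eb eqxx.
  (* Multiplying by [s t] flips both [b] and [phi] and fixes the coordinates in [L]; so [w] lies in
     the fibre of [u], and [phi b] agrees at [u] and [v]. *)
  pose w := tp v s t.
  have wx : lev w = lev x0 by rewrite !lev_tp vx sx tx !minnn.
  have wb : ev u b = ev w b.
    have [[ub _] [vb _] [sb _] [tb _]] :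
      [/\ ev u b <> Zero3 /\ phi u <> Zero3, ev v b <> Zero3 /\ phi v <> Zero3,
       ev s b <> Zero3 /\ phi s <> Zero3 & ev t b <> Zero3 /\ phi t <> Zero3].
      by split; apply: unit.
    rewrite bM; move: neb bst ub vb sb tb.
    by case: (ev u b) (ev v b) (ev s b) (ev t b) => [] [] [] [].
  have phiuw : phi u = phi w.
    apply: fib => //=; rewrite -/b wb eqxx /=; apply/allP => r rL.
    rewrite ev_tp; move/allP: uv => /(_ r rL)/eqP ->; move/allP: st => /(_ r rL)/eqP ->.
    have : ev t (B r) <> Zero3 by apply: (tp_mul_neq0 (tp_mul_ev (B r)) _ (B0 r)); rewrite tx.
    by case: (ev v (B r)) (ev t (B r)) => [] [].
  move: phist neb; rewrite phiuw phiM wb bM.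
  have [[_ v0] [_ s0]] : (ev v b <> Zero3 /\ phi v <> Zero3) /\ (ev s b <> Zero3 /\ phi s <> Zero3).
    by split; apply: unit.
  have [t1 t0] := unit t tx; have [s1 _] := unit s sx; have [v1 _] := unit v vx.
  move: bst v0 s0 t1 t0 s1 v1.
  by case: (ev v b) (ev s b) (ev t b) (phi v) (phi s) (phi t) => [] [] [] [] [] [].
have [c hc] := coord_mul a b; exists c => z zx; rewrite hc ha // /phib.
have [] := unit z zx.
by case: (phi z) (ev z b) => [] [].
Qed.

(** The next lower level has a strictly larger zero set; a coordinate witnessing this vanishes on
    all lower levels by the chain condition. *)
Lemma coord_vanishing_below (x0 : X) :
  exists c, ev x0 c <> Zero3 /\ forall z : X, lev z < lev x0 -> ev z c = Zero3.
Proof.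
have [z1 z1P | none] := pickP [pred z : X | lev z < lev x0]; last first.
  have [c hc] := coord_const Pos3; exists c; split; first by rewrite hc.
  by move=> z zx; have := none z; rewrite /= zx.
have [z0 z0x zmax] := @arg_maxnP _ z1 _ (@lev X) z1P.
have [c [c0 cx]] : exists c, ev z0 c = Zero3 /\ ev x0 c <> Zero3.
  apply: contrapT => none; move: z0x; rewrite /= ltnNge => /negP; apply.
  apply/lev_leP/ev_inj => c; rewrite ev_tp.
  have : ev z0 c = Zero3 -> ev x0 c = Zero3.
    by move=> c0; apply: contrapT => cx; apply: none; exists c.
  by case: (ev z0 c) (ev x0 c) => [] [] // ->.
exists c; split=> // z /zmax /lev_leP h.
by move/(congr1 (fun u => ev u c)): h; rewrite ev_tp c0; case: (ev z c).
Qed.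

(** Representing [phi] on the lowest level where it is nonzero suffices: higher levels project to
    it, and lower ones are killed by a square. *)
Lemma tp_mul_rep phi : tp_mul phi -> exists a, forall x : X, ev x a = phi x.
Proof.
move=> phiM.
have [x1 x1P | phi0] := pickP [pred x | phi x != Zero3]; last first.
  have [a ha] := coord_const Zero3; exists a => x; rewrite ha.
  by apply/esym/eqP/negbFE/phi0.
have [x0 /eqP x0P xmin] := @arg_minnP _ x1 _ (@lev X) x1P.
have [one oneE] := coord_const Pos3.
(* One separating coordinate per pair makes the fibres on this level singletons; [one] is the
   default for other pairs. *)
have /choice[B hB] : forall p : X * X, exists b, ev x0 b <> Zero3 /\
    (lev p.1 = lev x0 -> lev p.2 = lev x0 -> ev p.1 b = ev p.2 b -> p.1 = p.2).
  move=> [s t] /=; apply: contrapT => none.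
  have st : s <> t by move=> st; apply: none; exists one; rewrite oneE.
  apply: none; have [sx|] := pselect (lev s = lev x0); last by exists one; rewrite oneE.
  have [tx|] := pselect (lev t = lev x0); last by exists one; rewrite oneE.
  have [b bst] : exists b, ev s b <> ev t b.
    by apply/existsNP => e; apply: st; apply: ev_inj.
  exists b; split=> // b0; apply: bst.
  have zero z : lev z = lev x0 -> ev z b = Zero3.
    move=> zx; apply: contrapT => zb.
    by apply: (tp_mul_neq0 (tp_mul_ev b) _ zb) b0; rewrite zx.
  by rewrite !zero.
have [||||a ha] := @tp_mul_rep_level _ B (enum {: X * X}) x0 phi.
- by move=> p; have [] := hB p.
- exact: phiM.
- exact: x0P.
- move=> s t sx tx /allP/(_ (s, t)); rewrite mem_enum => /(_ isT)/eqP.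
  by move/(proj2 (hB (s, t)) sx tx) => /= ->.
(* [c^2] is 1 from the level of [x0] upwards and 0 below. *)
have [c [c0 cz]] := coord_vanishing_below x0.
have [c2 c2E] := coord_mul c c; have [d dE] := coord_mul a c2.
exists d => z; rewrite dE c2E; case: (ltnP (lev z) (lev x0)) => zx.
  rewrite cz //; have [->|zphi] := eqVneq (phi z) Zero3; first by case: (ev z a).
  by move: zx; rewrite ltnNge xmin.
have e : ev (tp x0 x0 z) a = phi (tp x0 x0 z).
  by apply: ha; rewrite lev_tp minnn; apply/minn_idPl.
rewrite phiM ev_tp ha // in e.
have zc : ev z c <> Zero3 by apply: (tp_mul_neq0 (tp_mul_ev c) zx c0).
by move: e x0P zc; case: (phi x0) (ev z a) (phi z) (ev z c) => [] [] [] [].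
Qed.

End Representation.

(** * Real semigroups and their characters *)

Section RealSemigroup.
Variable G : realSemigroupType.
Local Open Scope group_scope.
Implicit Types a b c d x : G.

Lemma tsoppM a b : tsopp a * b = tsopp (a * b).
Proof. by rewrite /tsopp mulgA. Qed.

Lemma tsoppK a : tsopp (tsopp a) = a.
Proof. by rewrite /tsopp mulgA tsmone_sqr mul1g. Qed.

Lemma transversal_mulr a b c d :
  transversal rsD b c a -> transversal rsD (b * d) (c * d) (a * d).
Proof.
by case=> h1 h2 h3; split; rewrite -?tsoppM; apply: RS2.
Qed.

(** Scaling reduces to [b = 1], where RS6 applied to RS1 shows that [D(1,-1)] is everything. *)
Lemma transversal_opp b x : transversal rsD b (tsopp b) (x * b).
Proof.
suff h : transversal rsD 1 (tsopp 1) x.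
  by have := transversal_mulr b h; rewrite tsoppM !mul1g.
have D1 (y : G) : rsD 1 (tsopp 1) y.
  have [_ _] := RS6 _ _ _ (RS1 1 (tsopp y)).
  by rewrite expg1n !mul1g tsoppK.
split; first exact: D1.
- by apply/RS0/RS1.
- by rewrite tsoppK; apply: RS1.
Qed.

(** RS3 combines [a] in [D^t(a, a^2 b)] with [a^2 b] in [D^t(b, -b)]. *)
Lemma transversal_nonempty a b : exists c, transversal rsD a b c.
Proof.
have h1 := RS6 _ _ _ (RS1 a b).
have h2 := transversal_opp b (a ^+ 2).
have [c hc _] := RS3 _ _ _ _ _ h1 h2.
exists c; move: hc; by rewrite -expgSr tscube.
Qed.

(* Otherwise an element of [D^t(a^2, b^2)] would be a nonzero value of
   [g^2 h], a character vanishing at [a^2] and [b^2]. *)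
Lemma fan_zeros_chain (g h : G -> three) : RS_fan G ->
  characters G g -> characters G h ->
  (forall a, g a = Zero3 -> h a = Zero3) \/ (forall a, h a = Zero3 -> g a = Zero3).
Proof.
move=> fanG gX hX; apply: contrapT => /not_orP[/existsNP[a na] /existsNP[b nb]].
move: na nb => /not_implyP[ga ha] /not_implyP[hb gb].
have [c [c1 c2 c3]] := transversal_nonempty (a ^+ 2) (b ^+ 2).
have [_ _ _ _ kD] := fanG g g h gX gX hX.
have [gM _ _ gN gD] := gX; have [hM _ _ hN hD] := hX.
move: (kD _ _ _ c1) (hD _ _ _ c2) (gD _ _ _ c3).
rewrite !inE !expgS !expg0 !mulg1 /tsopp !gM !hM gN hN ga hb.
move: ha gb.
by case: (g b) (h a) (g c) (h c) => [] [] [] [].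
Qed.

Lemma specializesP (g h : characters G) :
  specializes g h <-> forall a, \val h a * \val h a * \val g a = \val h a.
Proof.
have [_ _ _ gN _] := set_mem (valP g); have [gM _ _ _ _] := set_mem (valP g).
have [hM _ _ hN _] := set_mem (valP h).
split=> [gh a | gh a ha].
  case e : (\val h a) => //.
    (* The value -1 is handled by passing to [-a]. *)
    have /gh : (\val h @^-1` [set 1])%classic (tsmone * a) by rewrite /= hM hN e.
    by rewrite /= gM gN -[sval g]/(\val g); case: (\val g a).
  by have -> : \val g a = 1 by apply: gh.
change (\val g a = 1); move: (gh a); rewrite (ha : \val h a = 1).
by case: (\val g a).
Qed.

End RealSemigroup.

(** * Transfer to abstract real spectra *)

Lemma characters_fan_space (F : realSemigroupType) : finite_ARS_fan F ->
  exists (X : fan_space) (u : X -> characters F),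
    [/\ bijective u,
        forall x y, spec x y <-> specializes (u x) (u y) &
        forall phi : X -> three, tp_mul phi <-> exists a, phi =1 fun x => \val (u x) a].
Proof.
case=> fanF /finite_seqP[s sE].
have sX (x : seq_sub s) : characters F (ssval x) by rewrite sE; case: x.
have Xs (h : F -> three) : characters F h -> h \in s by rewrite sE.
pose tri (x y z : seq_sub s) := SeqSub (Xs _ (fanF _ _ _ (sX x) (sX y) (sX z))).
have tri_inj (x y : seq_sub s) : ssval x =1 ssval y -> x = y.
  by move=> /funext xy; apply: val_inj.
have triE (x y z : seq_sub s) a :
    ssval (tri x y z) a = mul3 (mul3 (ssval x a) (ssval y a)) (ssval z a) by [].
have tri_chain (x y : seq_sub s) : tri x x y = y \/ tri y y x = x.
  have [h | h] := fan_zeros_chain fanF (sX x) (sX y); [left | right];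
    apply: tri_inj => a; rewrite triE; have := h a;
    by case: (ssval x a) (ssval y a) => [] [] // /(_ erefl).
pose X := @FanSpace (seq_sub s : finType) F (fun x => ssval x) tri tri_inj triE tri_chain.
pose u (x : X) : characters F := exist _ (ssval x) (mem_set (sX x)).
exists X, u; split=> //.
- exists (fun h => SeqSub (Xs _ (set_mem (valP h)))).
    by move=> x; apply: val_inj.
  by move=> h; apply: val_inj.
- move=> x y; rewrite specializesP; split=> [/eqP e a | e].
    exact: (congr1 (fun w : X => ssval w a) e).
  by apply/eqP/tri_inj => a; rewrite triE; apply: e.
move=> phi; split=> [phiM | [a ha] x y z]; last first.
  by rewrite !ha.
have [||a ha] := @tp_mul_rep X _ _ phi phiM.
- have h0 (x : X) : ssval x tszero = Zero3 by have [] := sX x.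
  have h1 (x : X) : ssval x 1%g = Pos3 by have [] := sX x.
  have hN (x : X) : ssval x tsmone = Neg3 by have [] := sX x.
  by case; [exists tsmone | exists tszero | exists 1%g].
- by move=> a b; exists (a * b)%g => x; have [xM _ _ _ _] := sX x; apply: xM.
by exists a => x; rewrite -ha.
Qed.

Theorem theorem3p11 (F1 F2 : realSemigroupType)
    (hF1 : finite_ARS_fan F1) (hF2 : finite_ARS_fan F2)
    (hiso : specialization_isomorphic F1 F2) :
  ARS_isomorphic F1 F2.
Proof.
have [X1 [u1 [[v1 u1K v1K] spec1 hats1]]] := characters_fan_space hF1.
have [X2 [u2 [[v2 u2K v2K] spec2 hats2]]] := characters_fan_space hF2.
have [f f_bij f_spec] := hiso.
pose g x := v2 (f (u1 x)).
have g_bij : bijective g.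
  apply: bij_comp; first by exists u2.
  by apply: bij_comp => //; exists v1.
have g_spec x y : spec (g x) (g y) = spec x y.
  by apply/idP/idP; rewrite spec1 f_spec spec2 !v2K.
have [psi [psi' psiK psi'K] psi_tp] := order_iso_tp_iso g_bij g_spec.
have psi'_tp x y z : psi' (tp x y z) = tp (psi' x) (psi' y) (psi' z).
  by apply: (can_inj psiK); rewrite psi_tp !psi'K.
exists (fun h => u2 (psi (v1 h))), (fun h => u1 (psi' (v2 h))); split.
- by move=> h; rewrite u2K psiK v1K.
- by move=> h; rewrite u1K psi'K v2K.
(* Pulling [hat a] back along [psi] keeps it compatible with triple products, hence an
   evaluation. *)
- move=> a; have [|b hb] := (hats1 (fun x => \val (u2 (psi x)) a)).1.
    move=> x y z; rewrite psi_tp.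
    by apply: ((hats2 (fun x => \val (u2 x) a)).2 _ (psi x) (psi y) (psi z)); exists a.
  by exists b; apply/funext => h; rewrite /hat /= hb v1K.
- move=> a; have [|b hb] := (hats2 (fun x => \val (u1 (psi' x)) a)).1.
    move=> x y z; rewrite psi'_tp.
    by apply: ((hats1 (fun x => \val (u1 x) a)).2 _ (psi' x) (psi' y) (psi' z)); exists a.
  by exists b; apply/funext => h; rewrite /hat /= hb v2K.
Qed.
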